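(* Let $G=(X,Y,E)$ be a finite simple connected bipartite graph with at least three vertices and with bipartition classes $X$ and $Y$. Then $\mathrm{fgndi}_{\sum}(G)\leq 3$.
   Context: For a finite simple graph $G$ and an integer $k\ge 1$, a non-proper total $k$-coloring is an arbitrary map $f: V(G)\cup E(G)\rightarrow \{1,2,\dots,k\}$. Its weight function is $$\phi(x)=f(x)+\sum_{e\ni x}f(e)+\sum_{y\in N(x)}f(y)\quad (x\in V(G)),$$ where the first sum is over the edges $e$ incident with $x$ and $N(x)=\{y\in V(G): xy\in E(G)\}$. The coloring $f$ is called a neighbor full sum distinguishing (NFSD) total $k$-coloring if $\phi(x)\neq\phi(y)$ for every edge $xy\in E(G)$. The neighbor full sum distinguishing total chromatic number $\mathrm{fgndi}_{\sum}(G)$ is the smallest $k$ for which $G$ has an NFSD total $k$-coloring. *)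

(* Defs.v *)
From mathcomp Require Import all_boot.

Set Implicit Arguments.
Unset Strict Implicit.
Unset Printing Implicit Defensive.

Record sgraph := SGraph {
  vertex :> finType;
  adj : rel vertex;
  adj_sym : symmetric adj;
  adj_irrefl : irreflexive adj
}.

Definition edges (G : sgraph) : {set {set G}} :=
  [set [set p.1; p.2] | p in [set p : G * G | adj p.1 p.2]].

(* An edge is an unordered pair, so each one is coloured, and summed, once. *)
Definition edge (G : sgraph) : finType := {A : {set G} | A \in edges G}.

Definition connected (G : sgraph) : Prop :=
  forall x y : G, connect (@adj G) x y.

Definition bipartition (G : sgraph) (X Y : {set G}) : Prop :=
  [/\ X :|: Y = [set: G],
      [disjoint X & Y]
    & forall x y : G, adj x y ->
        (x \in X) && (y \in Y) || (x \in Y) && (y \in X)].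

(* Colours are the natural numbers 1, ..., k; no properness is required. *)
Definition total_coloring (G : sgraph) (k : nat) (f : G + edge G -> nat) : Prop :=
  forall z, 1 <= f z <= k.

Definition weight (G : sgraph) (f : G + edge G -> nat) (x : G) : nat :=
  f (inl x) + \sum_(e : edge G | x \in val e) f (inr e)
            + \sum_(y : G | adj x y) f (inl y).

Definition nfsd_coloring (G : sgraph) (k : nat) (f : G + edge G -> nat) : Prop :=
  total_coloring k f /\
  forall x y : G, adj x y -> weight f x <> weight f y.

Definition has_nfsd_coloring (G : sgraph) (k : nat) : Prop :=
  exists f : G + edge G -> nat, nfsd_coloring k f.

(* "fgndi_sum(G) is defined and equals k".  A relation rather than a function,
   since some graphs (e.g. K_2) have no NFSD colouring for any k. *)
Definition is_fgndi (G : sgraph) (k : nat) : Prop :=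
  [/\ 1 <= k,
      has_nfsd_coloring G k
    & forall j : nat, 1 <= j -> has_nfsd_coloring G j -> k <= j].

(* Main.v *)
Require Import Defs.
From mathcomp Require Import all_boot.
From mathcomp Require Import ssralg zmodp.
From Stdlib Require Import Classical_Prop.

(** Give every vertex the colour 3, so that modulo 3 the weight of [x] is the sum
    of the colours of the edges at [x].  It is then enough to label the edges by
    elements of Z/3 such that these sums vanish on one class of the bipartition
    and nowhere on the other; the residues 0, 1, 2 are coloured 3, 1, 2.

    In a connected bipartite graph the edge sums can be prescribed arbitrarily,
    up to one constraint: both classes must have the same total, as each edge
    contributes once to each of them ([edge_sums_prescribed]).  Put 0 on
    one class [X]; the other class [Y], chosen to have at least two
    elements, must carry nonzero residues of total 0.  Such residues exist because
    any residue modulo 3 is a sum of two nonzero ones, so that two vertices of [Y]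
    can compensate whatever the others contribute ([nonzero_zero_sum]). *)

Set Implicit Arguments.
Unset Strict Implicit.
Unset Printing Implicit Defensive.

Import GRing.Theory.

Lemma bipartition_sym (G : sgraph) (X Y : {set G}) :
  bipartition X Y -> bipartition Y X.
Proof.
case=> hU hD hadj; split; first by rewrite setUC.
  by rewrite disjoint_sym.
by move=> x y /hadj; rewrite orbC.
Qed.

Lemma bipartition_setC (G : sgraph) (X Y : {set G}) :
  bipartition X Y -> Y = ~: X.
Proof.
case=> hU; rewrite -setI_eq0 => /eqP hI _.
by apply/setP=> x; move/setP/(_ x): hU; move/setP/(_ x): hI;
   rewrite !inE; case: (x \in X); case: (x \in Y).
Qed.

Lemma adj_edge (G : sgraph) (x y : G) :
  adj x y -> [set x; y] \in edges G.
Proof. by move=> hxy; apply/imsetP; exists (x, y); rewrite ?inE. Qed.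

Section EdgeSums.

Local Open Scope ring_scope.

Variables (R : pzRingType) (G : sgraph) (X Y : {set G}).
Hypothesis hbip : bipartition X Y.

Definition edge_sum (g : edge G -> R) (x : G) : R :=
  \sum_(e : edge G | x \in val e) g e.

(** Changing the sign of the edge sums on [Y] turns a label on the edge [xy]
    into a flow from [x] to [y]: its two contributions become opposite. *)
Definition signed_edge_sum (g : edge G -> R) (x : G) : R :=
  (-1) ^+ (x \in Y) * edge_sum g x.

Lemma signed_edge_sum_sum (I : finType) (g : I -> edge G -> R) (x : G) :
  signed_edge_sum (fun e => \sum_i g i e) x = \sum_i signed_edge_sum (g i) x.
Proof. by rewrite /signed_edge_sum /edge_sum exchange_big mulr_sumr. Qed.

Lemma signed_edge_sumD (g h : edge G -> R) (x : G) :
  signed_edge_sum (fun e => g e + h e) x =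
  signed_edge_sum g x + signed_edge_sum h x.
Proof. by rewrite /signed_edge_sum /edge_sum big_split mulrDr. Qed.

Lemma adj_side (x y : G) : adj x y -> (y \in Y) = ~~ (x \in Y).
Proof.
case: (hbip) => _ _ hadj /hadj; rewrite (bipartition_setC hbip) !inE.
by case: (x \in X); case: (y \in X).
Qed.

Lemma transfer_adj (x y : G) (a : R) :
  adj x y -> exists g : edge G -> R,
    forall z, signed_edge_sum g z = a *+ (z == x) - a *+ (z == y).
Proof.
move=> hxy; have nxy : x != y.
  by apply/eqP=> e; move: hxy; rewrite e adj_irrefl.
pose e0 : edge G := Sub [set x; y] (adj_edge hxy).
(* The sign on the label cancels the one at [x], so the flow leaves from [x]
   whichever class [x] lies in. *)
exists (fun e => if e == e0 then (-1) ^+ (x \in Y) * a else 0) => z.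
rewrite /signed_edge_sum /edge_sum -big_mkcondr /=.
have -> : \sum_(e : edge G | (z \in val e) && (e == e0)) (-1) ^+ (x \in Y) * a
        = if z \in [set x; y] then (-1) ^+ (x \in Y) * a else 0.
  case: ifP => hz.
    rewrite (big_pred1 e0) // => e /=.
    by case: eqP => [->|]; rewrite ?andbF //= hz.
  by rewrite big_pred0 // => e; case: eqP => [->|]; rewrite ?andbF //= hz.
rewrite !inE; have [->|nzx] := eqVneq z x.
  by rewrite (negbTE nxy) /= mulrA -expr2 sqrr_sign mul1r subr0.
have [->|nzy] := eqVneq z y; last by rewrite /= mulr0 subr0.
rewrite /= (adj_side hxy) sub0r mulrA.
by case: (x \in Y); rewrite /= ?expr0 ?expr1 ?mulr1 ?mul1r mulN1r.
Qed.

Lemma transfer_connect (x y : G) (a : R) :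
  connect (@adj G) x y -> exists g : edge G -> R,
    forall z, signed_edge_sum g z = a *+ (z == x) - a *+ (z == y).
Proof.
case/connectP=> p; elim: p x => [|x' p IHp] x /=.
  move=> _ ->; exists (fun=> 0) => z.
  by rewrite /signed_edge_sum /edge_sum big1 // mulr0 subrr.
case/andP=> hxx' hp hy.
have [g hg] := transfer_adj a hxx'; have [h hh] := IHp x' hp hy.
by exists (fun e => g e + h e) => z; rewrite signed_edge_sumD hg hh addrA subrK.
Qed.

(** Fix a root [r] and send the signed demand of every vertex from there; what
    accumulates at [r] is the total signed demand, which is 0 by hypothesis. *)
Lemma edge_sums_prescribed (t : G -> R) :
  connected G -> \sum_(x in X) t x = \sum_(y in Y) t y ->
  exists g : edge G -> R, forall x, edge_sum g x = t x.
Proof.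
move=> hconn hbal; case: (pickP (fun _ : G => true)) => [r _|noG]; last first.
  by exists (fun=> 0) => x; move: (noG x).
pose d x := (-1) ^+ (x \in Y) * t x.
have d0 : \sum_x d x = 0.
  rewrite (bigID (mem Y)) /=; apply/eqP; rewrite addr_eq0; apply/eqP.
  transitivity (- \sum_(y in Y) t y).
    by rewrite -sumrN; apply: eq_bigr => y hy; rewrite /d hy mulN1r.
  rewrite -hbal; congr (- _); apply: eq_big => [x|x hx].
    by rewrite (bipartition_setC hbip) inE negbK.
  by rewrite /d (bipartition_setC hbip) inE hx mul1r.
have [g hg] := fin_all_exists (fun x => transfer_connect (d x) (hconn x r)).
exists (fun e => \sum_x g x e) => z.
have hz : signed_edge_sum (fun e => \sum_x g x e) z = d z.
  rewrite signed_edge_sum_sum (eq_bigr _ (fun x _ => hg x z)) sumrB.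
  rewrite sumrMnl d0 mul0rn subr0 (bigD1 z) //= eqxx mulr1n big1 ?addr0 //.
  by move=> x; rewrite eq_sym => /negbTE->.
have := congr1 (fun u => (-1) ^+ (z \in Y) * u) hz.
by rewrite /signed_edge_sum /d !mulrA -!expr2 !sqrr_sign !mul1r.
Qed.

End EdgeSums.

Section ModThree.

Local Open Scope ring_scope.

Lemma sum_two_nonzero (c : 'Z_3) :
  exists a b : 'Z_3, [/\ a != 0, b != 0 & a + b = c].
Proof.
case: c => [[|[|[|//]]]] hc; [exists 1, 2|exists 2, 2|exists 1, 1];
  by split=> //; apply/val_inj.
Qed.

Lemma nonzero_zero_sum (T : finType) (A : {set T}) :
  (1 < #|A|)%N ->
  exists t : T -> 'Z_3, (forall x, t x != 0) /\ \sum_(x in A) t x = 0.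
Proof.
case/card_gt1P=> u [v [hu hv nuv]].
(* With 1 everywhere else, [u] and [v] have to absorb the opposite of the rest. *)
have [a [b [na nb hab]]] :=
  sum_two_nonzero (- \sum_(x in A | (x != u) && (x != v)) 1).
exists (fun x => if x == u then a else if x == v then b else 1); split.
  by move=> x; case: ifP => // _; case: ifP.
rewrite (bigD1 u) //= eqxx (bigD1 v) /=; last by rewrite hv eq_sym.
rewrite eq_sym (negbTE nuv) eqxx addrA hab.
apply/eqP; rewrite addrC subr_eq0; apply/eqP.
apply: eq_big => [x|x /andP[/andP[_ /negbTE->] /negbTE->] //].
by rewrite -andbA.
Qed.

Definition color_of_residue (a : 'Z_3) : nat := if a == 0 then 3 else val a.

Lemma color_of_residue_bounds (a : 'Z_3) : (1 <= color_of_residue a <= 3)%N.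
Proof. by case: a => [[|[|[|//]]]]. Qed.

Lemma color_of_residueK (a : 'Z_3) : (color_of_residue a)%:R = a.
Proof. by apply/val_inj; case: a => [[|[|[|//]]]]. Qed.

Lemma weight_mod3 (G : sgraph) (g : edge G -> 'Z_3) (x : G) :
  (weight (fun z => match z with
                    | inl _ => 3%N
                    | inr e => color_of_residue (g e) end) x)%:R
  = edge_sum g x.
Proof.
have three0 : (3%:R : 'Z_3) = 0 by apply/val_inj.
rewrite /weight !natrD !natr_sum three0 add0r [X in _ + X]big1 // addr0.
by apply: eq_bigr => e _; rewrite color_of_residueK.
Qed.

End ModThree.

Lemma nfsd3_large_class (G : sgraph) (X Y : {set G}) :
  connected G -> bipartition X Y -> 1 < #|Y| -> has_nfsd_coloring G 3.
Proof.
move=> hconn hbip /nonzero_zero_sum[t [tN0 t0]].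
(* Adjacent vertices get different sums: one is 0, the other is not. *)
pose s x : 'Z_3 := if x \in Y then t x else 0%R.
have hbal : (\sum_(x in X) s x = \sum_(y in Y) s y)%R.
  rewrite [RHS](eq_bigr t) => [|y hy]; last by rewrite /s hy.
  rewrite t0 big1 // => x hx.
  by rewrite /s (bipartition_setC hbip) inE hx.
have [g hg] := edge_sums_prescribed hbip hconn hbal.
exists (fun z => match z with
                 | inl _ => 3
                 | inr e => color_of_residue (g e) end); split.
  by case=> // e; apply: color_of_residue_bounds.
move=> x y hxy /(congr1 (fun n => (n%:R : 'Z_3)%R)).
rewrite !weight_mod3 !hg /s (adj_side hbip hxy).
by case: (x \in Y) => /= /eqP; rewrite ?(negbTE (tN0 _)) // eq_sym (negbTE (tN0 _)).
Qed.

Lemma is_fgndi_exists (G : sgraph) (k : nat) :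
  1 <= k -> has_nfsd_coloring G k -> exists m, is_fgndi G m /\ m <= k.
Proof.
elim/ltn_ind: k => k IHk k1 hk.
have [[j [j1 hj jk]]|hmin] :=
  classic (exists j, [/\ 1 <= j, has_nfsd_coloring G j & j < k]).
  have [m [hm mj]] := IHk j jk j1 hj.
  by exists m; split=> //; apply: leq_trans mj (ltnW jk).
exists k; split=> //; split=> // j j1 hj.
by rewrite leqNgt; apply/negP=> jk; apply: hmin; exists j.
Qed.

Theorem theorem14 (G : sgraph) (X Y : {set G})
    (hconn : connected G) (hcard : 3 <= #|G|) (hbip : bipartition X Y) :
  exists k : nat, is_fgndi G k /\ k <= 3.
Proof.
apply: is_fgndi_exists => //.
have [hY|hY] := ltnP 1 #|Y|; first exact: nfsd3_large_class hbip hY.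
apply: (nfsd3_large_class hconn (bipartition_sym hbip)).
move: hcard; rewrite -(cardsC X) -(bipartition_setC hbip) => hXY.
by rewrite -(ltn_add2r #|Y|); apply: leq_trans hXY; rewrite !ltnS.
Qed.
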